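(* Let $p$ be a prime, $N=p^e$ with $e\ge1$, and $\Lambda_N(U)=U(U-1)^{N-1}\in\mathbb F_p[U]$. Let $Q=p^m$ with $m\ge1$ and put $s=p^{\gcd(e,m)}$. For $t\in\mathbb F_Q$ let $r_Q(t)=\#\{u\in\mathbb F_Q:\Lambda_N(u)=t\}$. Then $r_Q(0)=2$. Among nonzero target values, $$\#\{t\in\mathbb F_Q^\times:r_Q(t)=0\}=\frac Qs,$$ $$\#\{t\in\mathbb F_Q^\times:r_Q(t)=1\}=\frac{(Q-1)(s-2)}{s-1},$$ $$\#\{t\in\mathbb F_Q^\times:r_Q(t)=s\}=\frac{Q-s}{s(s-1)}.$$ Therefore $$\#\Lambda_N(\mathbb F_Q)=Q\left(1-\frac1s\right).$$
   Context: Fibres are counted as sets of $\mathbb F_Q$-rational points, without multiplicity. $\Lambda_N(\mathbb F_Q)$ denotes the image of $u\mapsto \Lambda_N(u)$ on $\mathbb F_Q$. *)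

(* Defs.v *)
From HB Require Import structures.
From mathcomp Require Import all_boot all_order all_algebra.

Set Implicit Arguments.
Unset Strict Implicit.
Unset Printing Implicit Defensive.

Import GRing.Theory.
Local Open Scope ring_scope.

(* [Lambda R N] has coefficients in the prime ring of R; by [map_Lambda] below,
   when R has characteristic p it is the base change of [Lambda 'F_p N]. *)
Definition Lambda (R : comNzRingType) (N : nat) : {poly R} :=
  'X * ('X - 1) ^+ (N - 1).

Lemma map_Lambda (R S : comNzRingType) (f : {rmorphism R -> S}) (N : nat) :
  map_poly f (Lambda R N) = Lambda S N.
Proof. by rewrite /Lambda rmorphM rmorphXn rmorphB /= map_polyX rmorph1. Qed.

Definition fibre_card (F : finFieldType) (N : nat) (t : F) : nat :=
  #|[set u : F | (Lambda F N).[u] == t]|.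

Definition Lambda_image (F : finFieldType) (N : nat) : {set F} :=
  [set (Lambda F N).[u] | u : F].

(* Main.v *)
Require Import Defs.
From HB Require Import structures.
From mathcomp Require Import all_boot all_order all_algebra.
From mathcomp Require Import finfield.
From mathcomp Require Import ring lra.

Set Implicit Arguments.
Unset Strict Implicit.
Unset Printing Implicit Defensive.

Import GRing.Theory.
Local Open Scope ring_scope.

(* For t != 0 the substitution w = 1 / (u - 1) turns Lambda_N(u) = t into the
   affine equation t w^N - w = 1, whose left-hand side is additive in w.  Its
   kernel is trivial, and then r(t) = 1, unless t = w^(1-N) for some w != 0, in
   which case the kernel is w * F_s and r(t) is 0 or s.  There are
   (Q - 1) / (s - 1) such t, and summing r over all t gives Q; together with
   r(0) = 2 this determines the three counts. *)

(** * Fixed points of Frobenius powers on a finite field *)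

Lemma subXn1_dvdp (R : idomainType) (a b : nat) :
  (a %| b)%N -> 'X^a - 1 %| ('X^b - 1 : {poly R}).
Proof.
move=> /dvdnP[k ->]; rewrite mulnC exprM [X in _ %| X]subrX1.
exact: dvdp_mulIl.
Qed.

(** Once a factor ['X] is split off, the hypothesis on [s.-1] makes ['X^s - 'X] divide
    ['X^#|F| - 'X], the product of all ['X - x] with [x] in [F]. Hence its roots are distinct and
    lie in [F], and its degree counts them. *)
Lemma card_fixed_Xn (F : finFieldType) (s : nat) :
    (1 < s)%N -> (s.-1 %| #|F|.-1)%N ->
  #|[set x : F | x ^+ s == x]| = s.
Proof.
move=> s_gt1 s_dvd; have XE k : (0 < k)%N ->
    'X^k - 'X = 'X * ('X^(k.-1) - 1) :> {poly F}.
  by case: k => // k _; rewrite exprS mulrBr mulr1.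
have: 'X^s - 'X %| ('X^#|F| - 'X : {poly F}).
  rewrite !XE ?(ltnW s_gt1) ?(ltnW (finNzRing_gt1 F)) //.
  by rewrite dvdp_mul2l ?polyX_eq0 // subXn1_dvdp.
rewrite finField_genPoly -big_enum /= => /dvdp_prod_XsubC[msk eq_msk].
have sz : size ('X^s - 'X : {poly F}) = s.+1.
  by rewrite size_polyDl size_polyXn // size_polyN size_polyX.
have := eqp_size eq_msk; rewrite sz size_prod_XsubC => -[s_eq].
rewrite [RHS]s_eq -(card_uniqP (mask_uniq (enum_uniq F) msk)).
apply: eq_card => x; rewrite !inE -root_prod_XsubC -(eqp_root eq_msk).
by rewrite rootE !hornerE subr_eq0.
Qed.

Lemma frobenius_iter_fixed (R : pzSemiRingType) (p a k : nat) (x : R) :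
  x ^+ (p ^ a) = x -> x ^+ (p ^ (a * k)) = x.
Proof.
by move=> fx; elim: k => [|k IH]; rewrite ?muln0 // mulnS expnD exprM fx.
Qed.

Lemma frobenius_fixed_gcd (F : finFieldType) (p e m : nat) (x : F) :
    (0 < e)%N -> #|F| = (p ^ m)%N ->
  (x ^+ (p ^ e) == x) = (x ^+ (p ^ gcdn e m) == x).
Proof.
move=> e_gt0 oF; apply/eqP/eqP => fx; last first.
  by case/dvdnP: (dvdn_gcdl e m) => k ->; rewrite mulnC; apply: frobenius_iter_fixed.
(* Bezout over the naturals gives [u * e = v * m + gcdn e m], and the power [p ^ (v * m)] acts as
   the identity on [F]. *)
case: (egcdnP m e_gt0) => u v eq_uv _.
have fm : x ^+ (p ^ (v * m)) = x.
  by rewrite mulnC; apply: frobenius_iter_fixed; rewrite -oF expf_card.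
rewrite -[RHS](frobenius_iter_fixed u fx) mulnC eq_uv expnD exprM.
by rewrite fm.
Qed.

Lemma prime_expn_gt1 (p n : nat) : prime p -> (0 < n)%N -> (1 < p ^ n)%N.
Proof. by move=> p_prime n_gt0; rewrite -(exp1n n) ltn_exp2r // prime_gt1. Qed.

(** * The kernel of the additive map [t * w ^+ N - w] *)

Section Fibres.
Variables (p e m : nat) (F : finFieldType).
Hypotheses (p_prime : prime p) (e_ge1 : (1 <= e)%N).
Hypothesis (cardF : #|F| = (p ^ m)%N).

Local Notation N := (p ^ e)%N.
Local Notation s := (p ^ gcdn e m)%N.

Definition twisted_kernel (t : F) := [set w : F | t * w ^+ N == w].

Lemma N_gt1 : (1 < N)%N.
Proof. exact: prime_expn_gt1. Qed.

Lemma s_gt1 : (1 < s)%N.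
Proof. by rewrite prime_expn_gt1 // gcdn_gt0 e_ge1. Qed.

Lemma exprN_sub (x y : F) : (x - y) ^+ N = x ^+ N - y ^+ N.
Proof.
have pchF : p \in [pchar F] by apply: card_finPcharP cardF p_prime.
have pN : [pchar F].-nat N by rewrite (eq_pnat _ (pcharf_eq pchF)) pnatX pnat_id.
(* Additivity is applied to [(x - y) + y], which avoids computing the sign [(-1) ^+ N]. *)
by apply: (addIr (y ^+ N)); rewrite subrK -exprDn_pchar // subrK.
Qed.

(** The kernel for [t = 1] is the fixed set of the [s]-power map; [s - 1] divides [Q - 1] because
    [Q] is a power of [s]. *)
Lemma card_twisted_kernel1 : #|twisted_kernel 1| = s.
Proof.
rewrite -[RHS](@card_fixed_Xn F) ?s_gt1 //.
  by apply: eq_card => w; rewrite !inE mul1r (frobenius_fixed_gcd w e_ge1 cardF).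
rewrite cardF; case/dvdnP: (dvdn_gcdr e m) => k {2}->.
by rewrite mulnC expnM dvdn_pred_predX.
Qed.

(** Multiplication by [w] carries the kernel for [1] bijectively onto the kernel for [t]. *)
Lemma card_twisted_kernel (t w : F) :
  w != 0 -> t * w ^+ N = w -> #|twisted_kernel t| = s.
Proof.
move=> w0 tw; rewrite -card_twisted_kernel1 -[RHS](card_imset _ (mulfI w0)).
have wN0 : w ^+ N != 0 by rewrite expf_neq0.
apply: eq_card => x; rewrite !inE; apply/idP/imsetP => [/eqP tx | [y]].
  exists (x / w); last by rewrite mulrC divfK.
  rewrite inE mul1r expr_div_n -{2}tx -{2}tw.
  have t0 : t != 0 by apply: contra_neq w0 => t0; rewrite -tw t0 mul0r.
  by rewrite -mulf_div divff // mul1r.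
by rewrite inE mul1r => /eqP yN ->; rewrite exprMn yN mulrA tw.
Qed.

(** * Fibres over nonzero values *)

Lemma fibre_card_twisted (t : F) : t != 0 ->
  fibre_card N t = #|[set w : F | t * w ^+ N - w == 1]|.
Proof.
move=> t0; rewrite /fibre_card.
(* Since [0^-1 = 0], this map is injective on all of [F] and sends [w = 0] to [u = 1]. Neither point
   is a solution: [Lambda] vanishes at [1] while [t != 0], and the left-hand side at [w = 0] is [0],
   not [1]. *)
have inj : injective (fun w : F => w^-1 + 1) by move=> x y /addIr/invr_inj.
rewrite -[RHS](card_imset _ inj); apply: eq_card => u; rewrite !inE.
rewrite /Lambda !hornerE /= subn1.
have NE : N = N.-1.+1 by rewrite prednK // ltnW // N_gt1.
have key (w : F) : w != 0 ->
    ((w^-1 + 1) * (w^-1) ^+ N.-1 == t) = (t * w ^+ N - w == 1).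
  move=> w0; have wn0 : w ^+ N.-1 != 0 by rewrite expf_neq0.
  rewrite {2}NE exprVn -[t in LHS](mulfK wn0) (inj_eq (mulIf (invr_neq0 wn0))).
  rewrite subr_eq -[in LHS](inj_eq (mulIf w0)) mulrDl mulVf // mul1r.
  by rewrite -mulrA -exprSr eq_sym.
apply/idP/imsetP => [Lu | [w]].
  have u1 : u - 1 != 0.
    apply: contraTneq Lu => ->; rewrite expr0n eqn0Ngt -ltnS -NE N_gt1.
    by rewrite mulr0 eq_sym.
  exists (u - 1)^-1; last by rewrite invrK subrK.
  by rewrite inE -key ?invr_eq0 // invrK subrK.
rewrite inE => Aw ->; have w0 : w != 0.
  apply: contraTneq Aw => ->; rewrite expr0n eqn0Ngt ltnW ?N_gt1 //=.
  by rewrite mulr0 subr0 eq_sym oner_eq0.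
by rewrite addrK key.
Qed.

(** By additivity the solutions form the translate of the kernel by [w0]. *)
Lemma card_twisted_fibre (t w0 : F) : t * w0 ^+ N - w0 = 1 ->
  #|[set w : F | t * w ^+ N - w == 1]| = #|twisted_kernel t|.
Proof.
move=> Aw0; rewrite -[RHS](card_imset _ (addIr w0)).
have AB x y : t * (x - y) ^+ N - (x - y) = (t * x ^+ N - x) - (t * y ^+ N - y).
  by rewrite exprN_sub; ring.
apply: eq_card => x; rewrite !inE; apply/idP/imsetP => [/eqP Ax | [y]].
  exists (x - w0); last by rewrite subrK.
  by rewrite inE -subr_eq0 AB Ax Aw0 subrr.
rewrite inE -subr_eq0 => Ay ->.
by move: Ay; rewrite -{1 2}(addrK w0 y) AB Aw0 subr_eq0.
Qed.

(** This is [t = w^(1-N)] with the inverse cleared; equivalently, the kernel for [t] is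
    nontrivial. *)
Definition twisted_power (t : F) := [exists w : F, (w != 0) && (t * w ^+ N == w)].

Lemma fibre_card_power (t : F) : t != 0 -> twisted_power t ->
  (fibre_card N t == 0%N) || (fibre_card N t == s).
Proof.
move=> t0 /existsP[w /andP[w0 /eqP tw]]; rewrite fibre_card_twisted //.
have [->|[w1]] := set_0Vmem [set w : F | t * w ^+ N - w == 1].
  by rewrite cards0.
rewrite inE => /eqP /card_twisted_fibre ->.
by rewrite (card_twisted_kernel w0 tw) eqxx orbT.
Qed.

(** A trivial kernel makes the additive map injective, hence bijective on the finite field, so it
    takes the value [1] exactly once. *)
Lemma fibre_card_nonpower (t : F) : t != 0 -> ~~ twisted_power t ->
  fibre_card N t = 1%N.
Proof.
move=> t0 /existsPn nP; rewrite fibre_card_twisted //.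
have Ainj : injective (fun w : F => t * w ^+ N - w).
  move=> x y /eqP; rewrite -subr_eq0 => /eqP Axy; apply/eqP; rewrite -subr_eq0.
  apply/contraT => xy; have /negP[] := nP (x - y); rewrite xy exprN_sub /=.
  by rewrite -subr_eq0 -{}Axy; apply/eqP; ring.
have /codomP[w1 Aw1] : 1 \in codom (fun w : F => t * w ^+ N - w).
  exact: injF_onto.
rewrite -[RHS](cards1 w1); apply: eq_card => w; rewrite !inE.
by rewrite Aw1 (inj_eq Ainj).
Qed.

(** * Counts over the whole field *)

Lemma fibre_card_0 : fibre_card N (0 : F) = 2%N.
Proof.
have <- : #|[set (0 : F); 1]| = 2%N by rewrite cards2 eq_sym oner_neq0.
apply: eq_card => u; rewrite !inE /Lambda !hornerE /=.
by rewrite mulf_eq0 expf_eq0 subn_gt0 N_gt1 subr_eq0.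
Qed.

Lemma sum_fibre_card : (\sum_(t : F) fibre_card N t)%N = #|F|.
Proof.
rewrite -sum1_card [RHS](partition_big (fun u : F => (Lambda F N).[u]) predT) //=.
apply: eq_bigr => t _; rewrite /fibre_card -sum1_card.
by apply: eq_bigl => u; rewrite inE.
Qed.

(** Each nonzero [w] lies in the kernel of exactly one [t], namely [w / w ^+ N]. Sorting the nonzero
    [w] by this value gives each such [t] its kernel without [0], which has [s - 1] elements. *)
Lemma card_twisted_power :
  muln #|[set t : F | (t != 0) && twisted_power t]| s.-1 = #|F|.-1.
Proof.
have -> : #|F|.-1 = #|[set w : F | w != 0]|.
  by rewrite -(cardC1 (0 : F)); apply: eq_card => w; rewrite !inE.
rewrite -[RHS]sum1_card -sum_nat_const.
rewrite [RHS](partition_big (fun w : F => w / w ^+ N)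
   (mem [set t : F | (t != 0) && twisted_power t])) /=; last first.
  move=> w; rewrite !inE => w0; rewrite mulf_neq0 ?invr_neq0 ?expf_neq0 //=.
  by apply/existsP; exists w; rewrite w0 divfK ?expf_neq0 /=.
apply: eq_bigr => t; rewrite inE => /andP[t0 /existsP[w /andP[w0 /eqP tw]]].
rewrite -(card_twisted_kernel w0 tw) (cardsD1 0) inE expr0n.
rewrite eqn0Ngt (ltnW N_gt1) mulr0 eqxx /= -sum1_card.
apply: eq_bigl => x; rewrite !inE; apply: andb_id2l => x0.
by rewrite -[RHS](inj_eq (mulIf (expf_neq0 N x0))) /= divfK ?expf_neq0 // eq_sym.
Qed.

End Fibres.

(** * Solving for the counts *)

Theorem corollary5p4 (p e m : nat) (F : finFieldType)
    (p_prime : prime p) (e_ge1 : (1 <= e)%N) (m_ge1 : (1 <= m)%N)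
    (cardF : #|F| = (p ^ m)%N) :
  let N := (p ^ e)%N in
  let r := fun t : F => fibre_card N t in
  let Q : rat := (p ^ m)%:R in
  let s := (p ^ gcdn e m)%N in
  let sQ : rat := s%:R in
  [/\ r 0 = 2%N,
      #|[set t : F | (t != 0) && (r t == 0%N)]|%:R = Q / sQ,
      #|[set t : F | (t != 0) && (r t == 1%N)]|%:R
        = (Q - 1) * (sQ - 2) / (sQ - 1),
      #|[set t : F | (t != 0) && (r t == s)]|%:R
        = (Q - sQ) / (sQ * (sQ - 1))
    & #|Lambda_image F N|%:R = Q * (1 - 1 / sQ)].
Proof.
move=> N r Q s sQ.
pose n (k : nat) := #|[set t : F | (t != 0) && (r t == k)]|.
have s_gt1 : (1 < s)%N by apply: s_gt1.
have r0 : r 0 = 2%N by apply: (@fibre_card_0 p e).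
have r_cases t : t != 0 -> [|| r t == 0%N, r t == 1%N | r t == s].
  move=> t0; have [tP|tP] := boolP (twisted_power p e t).
    by case/orP: (fibre_card_power p_prime e_ge1 cardF t0 tP) => ->; rewrite ?orbT.
  by rewrite {2}/r (fibre_card_nonpower p_prime e_ge1 cardF t0 tP) eqxx orbT.
have nE k : n k = (\sum_(t : F | t != 0%R) (r t == k))%N.
  rewrite /n -sum1dep_card big_mkcondr /=; apply: eq_bigr => t _.
  by case: (r t == k).
have cardF' : #|F|.-1 = (\sum_(t : F | t != 0%R) 1)%N.
  by rewrite sum1_card -(cardC1 (0 : F)).
have count_t : (n 0%N + n 1%N + n s = #|F|.-1)%N.
  rewrite cardF' !nE -!big_split; apply: eq_bigr => t /r_cases.
  by case/or3P=> /eqP ->; rewrite ?eqxx //=; move: s_gt1; case: (s) => [|[|]].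
(* The fibres partition [F]; the summand [2] is the fibre over [0]. *)
have count_u : (n 1%N + s * n s + 2 = #|F|)%N.
  rewrite -(sum_fibre_card p e) (bigD1 (0 : F)) //= -/N -/(r _) r0 addnC; congr addn.
  rewrite !nE big_distrr -big_split; apply: eq_bigr => t /r_cases.
  rewrite -/(r t); case/or3P=> /eqP ->; rewrite ?eqxx //=.
  - by move: s_gt1; case: (s) => [|[|]] //= k; rewrite muln0.
  - by move: s_gt1; case: (s) => [|[|]] //= k; rewrite muln0.
  - by move: s_gt1; case: (s) => [|[|]] //= k; rewrite muln1.
have count_powers : ((n 0%N + n s) * s.-1 = #|F|.-1)%N.
  rewrite -(card_twisted_power p_prime e_ge1 cardF); congr muln.
  (* For nonzero [t], being a twisted power amounts to [r t] being [0] or [s]; [1 < s] keeps these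
     values apart from each other and from [1]. *)
  rewrite !nE -big_split /= -sum1dep_card big_mkcondr; apply: eq_bigr => t t0 /=.
  case: ifPn => tP.
    case/orP: (fibre_card_power p_prime e_ge1 cardF t0 tP) => /eqP rt.
      by rewrite {1 2}/r rt /= eq_sym gtn_eqF // ltnW.
    by rewrite {1 2}/r rt eqxx gtn_eqF // ltnW.
  rewrite {1 2}/r (fibre_card_nonpower p_prime e_ge1 cardF t0 tP) /=.
  by rewrite ltn_eqF.
have count_image : (#|Lambda_image F N| + n 0%N = #|F|)%N.
  rewrite -(cardsC (Lambda_image F N)); congr addn; apply: eq_card => t.
  rewrite !inE; apply/andP/idP => [[t0 /eqP rt]|tI].
    apply/imsetP => -[u _ tu].
    by have := card0_eq rt u; rewrite !inE -tu eqxx.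
  have rt : r t = 0%N.
    apply/eqP; rewrite cards_eq0; apply/eqP/setP => u; rewrite !inE.
    by apply/eqP => Lu; case/negP: tI; apply/imsetP; exists u.
  (* The value [0] is never missed, since [r 0 = 2]. *)
  by split; [apply: contra_eqN rt => /eqP ->; rewrite r0 | rewrite rt].
rewrite -/(n 0%N) -/(n 1%N) -/(n s).
have QE : Q = #|F|%:R by rewrite cardF.
have Q1E : #|F|.-1%:R = Q - 1.
  by rewrite QE -subn1 natrB // ltnW // finNzRing_gt1.
have s1E : s.-1%:R = sQ - 1 by rewrite -subn1 natrB // ltnW.
have sQ0 : sQ != 0 by rewrite Num.Theory.pnatr_eq0 -lt0n ltnW.
have sQ1 : sQ - 1 != 0 by rewrite -s1E Num.Theory.pnatr_eq0 -lt0n -subn1 subn_gt0.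
have e1 : (n 0%N)%:R + (n 1%N)%:R + (n s)%:R = Q - 1.
  by rewrite -Q1E -count_t !natrD.
have e2 : (n 1%N)%:R + sQ * (n s)%:R + 2 = Q.
  by rewrite QE -count_u !natrD natrM.
have e3 : (n 0%N)%:R + (n s)%:R = (Q - 1) / (sQ - 1).
  by apply: (mulIf sQ1); rewrite divfK // -natrD -s1E -natrM count_powers.
have e4 : #|Lambda_image F N|%:R + (n 0%N)%:R = Q.
  by rewrite QE -count_image natrD.
have ns : (n s)%:R = (Q - sQ) / (sQ * (sQ - 1)).
  apply: (mulfI sQ0).
  (* Subtracting [e1] from [e2] eliminates [n 1]; [e3] then supplies the sum that remains. *)
  have -> : sQ * (n s)%:R = (n 0%N)%:R + (n s)%:R - 1 by lra.
  by rewrite e3; field; rewrite sQ0 sQ1.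
have n0 : (n 0%N)%:R = Q / sQ.
  by rewrite -(addrK (n s)%:R (n 0%N)%:R) e3 ns; field; rewrite sQ0 sQ1.
split=> //.
  have -> : (n 1%N)%:R = Q - 1 - ((n 0%N)%:R + (n s)%:R) by lra.
  by rewrite e3; field.
by rewrite -(addrK (n 0%N)%:R #|_|%:R) e4 n0; field.
Qed.
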